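(* Let $R=\mathbb R[x,y,z]$ and let $r\ge 0$ be an integer. Let $$I_1=\langle x^{r+1},(x+y)^{r+1}\rangle : y^{r+1},\qquad I_2=\langle z^{r+1},(z+y)^{r+1}\rangle : y^{r+1}$$ be the colon ideals in $R$. Then $$\dim_{\mathbb R}(I_1\cap I_2)_r=\begin{cases} n, & \text{if } r=2n-1,\\ n+1, & \text{if } r=2n.\end{cases}$$
   Context: $R=\mathbb R[x,y,z]$ has the standard grading, and for a homogeneous ideal $I$, $I_r$ denotes its degree-$r$ homogeneous component, so $\dim_{\mathbb R} I_r$ is the Hilbert function of $I$ in degree $r$. For an ideal $J$ and $g\in R$, $J:g=\{f\in R: fg\in J\}$. *)

(* Defs.v *)
From HB Require Import structures.
From mathcomp Require Import all_boot all_order all_algebra.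
From mathcomp Require Import boolp reals.
From mathcomp Require Import mpoly.

Set Implicit Arguments.
Unset Strict Implicit.
Unset Printing Implicit Defensive.

Import GRing.Theory.
Local Open Scope ring_scope.

(* The ideals of [ring_quotient] are boolean predicates and are required to be
   proper; colon ideals can be the whole ring, hence this Prop version. *)
Record ideal (A : comNzRingType) := Ideal {
  in_ideal :> A -> Prop;
  ideal0 : in_ideal 0;
  idealD : forall f g, in_ideal f -> in_ideal g -> in_ideal (f + g);
  idealM : forall a f, in_ideal f -> in_ideal (a * f)
}.

Section Operations.
Variable A : comNzRingType.
Implicit Types (I J : ideal A) (s : seq A) (f g : A).

Definition in_gen s f : Prop :=
  exists c : 'I_(size s) -> A, f = \sum_i c i * s`_i.

Fact in_gen0 s : in_gen s 0.
Proof. by exists (fun=> 0); rewrite big1 // => i _; rewrite mul0r. Qed.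

Fact in_genD s f g : in_gen s f -> in_gen s g -> in_gen s (f + g).
Proof.
move=> [c ->] [d ->]; exists (fun i => c i + d i).
by rewrite -big_split; apply: eq_bigr => i _; rewrite mulrDl.
Qed.

Fact in_genM s a f : in_gen s f -> in_gen s (a * f).
Proof.
move=> [c ->]; exists (fun i => a * c i).
by rewrite mulr_sumr; apply: eq_bigr => i _; rewrite mulrA.
Qed.

Definition ideal_gen s : ideal A := Ideal (in_gen0 s) (@in_genD s) (@in_genM s).

Definition in_colon J g f : Prop := J (f * g).

Fact in_colon0 J g : in_colon J g 0.
Proof. by rewrite /in_colon mul0r; apply: ideal0. Qed.

Fact in_colonD J g f1 f2 :
  in_colon J g f1 -> in_colon J g f2 -> in_colon J g (f1 + f2).
Proof. by rewrite /in_colon mulrDl; apply: idealD. Qed.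

Fact in_colonM J g a f : in_colon J g f -> in_colon J g (a * f).
Proof. by rewrite /in_colon -mulrA; apply: idealM. Qed.

Definition ideal_colon J g : ideal A :=
  Ideal (in_colon0 J g) (@in_colonD J g) (@in_colonM J g).

Definition in_cap I J f : Prop := I f /\ J f.

Fact in_cap0 I J : in_cap I J 0.
Proof. by split; apply: ideal0. Qed.

Fact in_capD I J f g : in_cap I J f -> in_cap I J g -> in_cap I J (f + g).
Proof. by move=> [? ?] [? ?]; split; apply: idealD. Qed.

Fact in_capM I J a f : in_cap I J f -> in_cap I J (a * f).
Proof. by move=> [? ?]; split; apply: idealM. Qed.

Definition ideal_cap I J : ideal A :=
  Ideal (in_cap0 I J) (@in_capD I J) (@in_capM I J).

End Operations.

(* A linear subset of a finite-dimensional space is a [{vspace _}]. *)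
Lemma vspace_of_linear (K : fieldType) (V : vectType K) (S : V -> Prop) :
  S 0 -> (forall a u v, S u -> S v -> S (a *: u + v)) ->
  exists U : {vspace V}, forall v, v \in U <-> S v.
Proof.
move=> S0 SL.
pose P k := `[< exists U : {vspace V}, (forall v, v \in U -> S v) /\ \dim U = k >].
have exP : exists k, P k.
  exists 0%N; apply/asboolP; exists 0%VS; split; last exact: dimv0.
  by move=> v; rewrite memv0 => /eqP ->.
have ubP k : P k -> (k <= \dim {:V})%N.
  by move=> /asboolP[U [_ <-]]; apply/dimvS/subvf.
case: (ex_maxnP exP ubP) => k /asboolP[U [US dimU]] maxk.
exists U => v; split; first exact: US.
move=> Sv; have US' : P (\dim (U + <[v]>)%VS).
  apply/asboolP; exists (U + <[v]>)%VS; split => // w.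
  move=> /memv_addP[u Uu [_ /vlineP[a ->] ->]].
  by rewrite addrC; apply: SL => //; apply: US.
have /eqP E : U == (U + <[v]>)%VS.
  by rewrite eqEdim addvSl dimU maxk.
by rewrite E; apply: (subvP (addvSr U _)); apply: memv_line.
Qed.

Section GradedComponent.
Variables (K : fieldType) (n : nat) (I : ideal {mpoly K[n.+1]}) (d : nat).

Fact hcomp_subproof :
  exists U : {vspace dhomog n.+1 K d}, forall p : dhomog n.+1 K d,
    p \in U <-> I (mpoly_of_dhomog p).
Proof.
apply: (vspace_of_linear (S := fun p : dhomog n.+1 K d => I (mpoly_of_dhomog p))).
  exact: ideal0.
move=> a u v Iu Iv /=; apply: idealD => //.
by rewrite -mul_mpolyC; apply: idealM.
Qed.

(* The degree-[d] component of [I], as a subspace of the space [dhomog n.+1 K d]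
   of [d]-homogeneous polynomials. *)
Definition hcomp : {vspace dhomog n.+1 K d} := projT1 (cid hcomp_subproof).

Lemma mem_hcomp (p : dhomog n.+1 K d) : p \in hcomp <-> I (mpoly_of_dhomog p).
Proof. exact: (projT2 (cid hcomp_subproof)). Qed.

End GradedComponent.

(* Main.v *)
(* Put N = r + 1 and work in the chart y = 1, where x^N and (x + y)^N become X^N
   and (X + 1)^N.  For k + t = N, the map (a, b) |-> a X^N + b (X + 1)^N from pairs
   of polynomials of degree < t is a bijection onto polynomials of degree < k + 2t
   modulo those of degree < k (a nondegenerate Pade problem).  Hence for each i <= r
   there is a monic e_i of degree i with e_i = a X^N + b (X + 1)^N and
   deg a, deg b <= r - i; homogenized, e_i(x, y) y^(2r+1-2i) lies in (x^N, (x + y)^N).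
   The forms y^(r-i-j) e_i(x, y) e_j(z, y), i + j <= r, are a basis of R_r, and by
   uniqueness in the Pade problem those with i >= j span (I_1)_r.  By the symmetry
   x <-> z, those with i <= j span (I_2)_r, so (I_1 cap I_2)_r has the basis
   y^(r-2i) e_i(x, y) e_i(z, y), 2i <= r. *)
From HB Require Import structures.
Require Import Defs.
From mathcomp Require Import all_boot all_order all_algebra.
From mathcomp Require Import boolp reals mpoly.
From mathcomp Require Import zify ring.
Import Order.TTheory GRing.Theory Num.Theory.
Local Open Scope ring_scope.

(* [lia] tells apart convertible copies of [size p] that differ in the structure
   from which the type of the coefficients is projected; [psize] merges them. *)
Definition psize (A : nzSemiRingType) (p : {poly A}) : nat := size p.
Ltac size_lia :=
  repeat match goal with
  | H : context C [@size _ (@polyseq ?A ?p)] |- _ =>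
    let e := context C [@psize A p] in change e in H
  | |- context C [@size _ (@polyseq ?A ?p)] =>
    let e := context C [@psize A p] in change e
  end; lia.

(** * The nondegenerate Pade problem for [X^N] and [(X + 1)^N] *)

Section Univariate.
Set Implicit Arguments.
Unset Strict Implicit.
Variable K : numFieldType.
Implicit Types p q a b : {poly K}.

(** Characteristic zero enters here: the new leading coefficient is the old one times the degree,
    and this does not vanish. *)
Lemma size_deriv_num p : size p^`() = (size p).-1.
Proof.
have [le_p1|lt1p] := leqP (size p) 1.
  by rewrite (size1_polyC le_p1) derivC size_poly0 size_polyC; case: eqP.
apply/eqP; rewrite eqn_leq; apply/andP; split.
  apply/leq_sizeP => j lej; rewrite coef_deriv nth_default ?mul0rn //; size_lia.
have -> : (size p).-1 = (size p).-2.+1 by size_lia.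
rewrite ltnNge; apply/negP => /leq_sizeP/(_ (size p).-2 (leqnn _))/eqP.
rewrite coef_deriv mulrn_eq0 /= => /eqP e.
have : lead_coef p = 0 by rewrite /lead_coef -[RHS]e; congr (_`_ _); size_lia.
by move/eqP; rewrite lead_coef_eq0 => /eqP p0; rewrite p0 size_poly0 in lt1p.
Qed.

Lemma size_derivn_num k p : size p^`(k) = (size p - k)%N.
Proof.
elim: k => [|k IH]; first by rewrite derivn0 subn0.
by rewrite derivnS size_deriv_num IH subnS.
Qed.

Lemma dvdp_exp_deriv q m p : (q ^+ m.+1 %| p) -> (q ^+ m %| p^`()).
Proof.
move=> /dvdpP[c ->]; rewrite derivM deriv_exp /= dvdp_add //.
  by rewrite exprS mulrA dvdp_mull.
by rewrite -mulrnAl dvdp_mull ?dvdp_mull.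
Qed.

Lemma dvdp_exp_derivn q k m p : (q ^+ (m + k) %| p) -> (q ^+ m %| p^`(k)).
Proof.
elim: k m => [|k IH] m; first by rewrite addn0 derivn0.
by rewrite addnS -addSn => /IH; rewrite derivnS; apply: dvdp_exp_deriv.
Qed.

Lemma size_exp_deg1 q m : size q = 2 -> size (q ^+ m) = m.+1.
Proof.
move=> sq; have nz : q ^+ m != 0.
  by rewrite expf_eq0 -size_poly_eq0 sq andbF.
by rewrite (polySpred nz) size_exp sq mul1n.
Qed.

(* Differentiating k times kills the left-hand side; what is left of either
   summand has degree less than 2t and is divisible by X^t and by (X+1)^t. *)
Lemma pade_unique (k t : nat) a b :
  (size a <= t)%N -> (size b <= t)%N ->
  (size (a * 'X^(k + t) + b * ('X + 1) ^+ (k + t))%R <= k)%N -> a = 0 /\ b = 0.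
Proof.
move=> sa sb s0.
have sX1 : size ('X + 1 : {poly K}) = 2 by rewrite size_XaddC.
set A : {poly K} := a * _ in s0; set B : {poly K} := b * _ in s0.
have AB : A^`(k) + B^`(k) = 0.
  by apply/eqP; rewrite -derivnD -size_poly_eq0 size_derivn_num subn_eq0.
have dA : 'X^t %| A^`(k) by apply: dvdp_exp_derivn; rewrite addnC dvdp_mull.
have dA' : ('X + 1) ^+ t %| A^`(k).
  rewrite -dvdpNr (addr0_eq AB).
  by apply: dvdp_exp_derivn; rewrite addnC dvdp_mull.
have cop : coprimep ('X^t : {poly K}) (('X + 1) ^+ t).
  apply: coprimep_expl; apply: coprimep_expr.
  rewrite -['X]subr0 -polyC0 coprimep_sym coprimep_XsubC /root !hornerE.
  by rewrite oppr0 add0r oner_neq0.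
have A0 : A^`(k) = 0.
  apply/eqP/negPn/negP => nz.
  have : ('X^t * ('X + 1) ^+ t : {poly K}) %| A^`(k) by rewrite Gauss_dvdp ?dA.
  move/dvdp_leq => /(_ nz); rewrite size_derivn_num size_monicM ?monicXn //; last first.
    by rewrite -size_poly_gt0 size_exp_deg1.
  rewrite (size_exp_deg1 _ sX1) size_polyXn.
  by have := size_polyMleq a 'X^(k + t); rewrite -/A size_polyXn; size_lia.
(* A vanishing k-th derivative means that [c * q ^+ (k + t)] has size at most k, whereas a nonzero c
   would force size at least k + t + 1. *)
have small (c q : {poly K}) :
    size q = 2 -> (c * q ^+ (k + t))^`(k) = 0 -> (size c <= t)%N -> c = 0.
  move=> sq /eqP; rewrite -size_poly_eq0 size_derivn_num subn_eq0 => le_k sc.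
  apply/eqP/negPn/negP => nz.
  move: le_k; rewrite size_mul // -?size_poly_gt0 (size_exp_deg1 _ sq) //.
  move: nz; rewrite -size_poly_gt0; size_lia.
split; first exact: small (size_polyX _) A0 sa.
by apply: small sX1 _ sb; rewrite -/B -[LHS](addKr (A^`(k))) AB A0 oppr0 addr0.
Qed.

(** Sending (a, b) to the coefficients of degrees k, ..., k + 2t + 1 of the combination is an
    endomorphism of a space of dimension 2(t + 1). It is injective by [pade_unique], hence
    bijective, and the preimage of the first unit vector gives a monic combination of degree k. *)
Lemma pade_exists (k t : nat) : exists a b,
  [/\ (size a <= t.+1)%N, (size b <= t.+1)%N,
      size (a * 'X^(k + t.+1) + b * ('X + 1) ^+ (k + t.+1)) = k.+1 &
      a * 'X^(k + t.+1) + b * ('X + 1) ^+ (k + t.+1) \is monic].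
Proof.
pose n := t.+1; pose N := (k + n)%N.
pose P (v : 'rV[K]_(n + n)) : {poly K} :=
  rVpoly (lsubmx v) * 'X^N + rVpoly (rsubmx v) * ('X + 1) ^+ N.
have sX1 : size ('X + 1 : {poly K}) = 2 by rewrite size_XaddC.
have sP v : (size (P v) <= k + (n + n))%N.
  have sz (w : 'rV[K]_n) (q : {poly K}) : size q = 2 ->
    (size (rVpoly w * q ^+ N)%R <= k + (n + n))%N.
    move=> sq; apply: leq_trans (size_polyMleq _ _) _.
    rewrite (size_exp_deg1 _ sq) addnS /= /N addnCA leq_add2l leq_add2r.
    exact: size_poly.
  by apply: leq_trans (size_polyD _ _) _; rewrite geq_max !sz ?size_polyX.
pose f v : 'rV[K]_(n + n) := \row_j (P v)`_(k + j).
have fD : linear f.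
  move=> c u v; apply/rowP => j; rewrite !mxE -coefZ -coefD; congr (_`_ _).
  by rewrite /P !linearP /= !mulrDl scalerDr !scalerAl addrACA.
pose L : {linear 'rV[K]_(n + n) -> 'rV[K]_(n + n)} :=
  HB.pack f (GRing.isLinear.Build _ _ _ _ f fD).
have Mfree : row_free (lin1_mx L).
  apply: inj_row_free => v; rewrite mul_rV_lin1 => /rowP fv0.
  have [] := @pade_unique k n (rVpoly (lsubmx v)) (rVpoly (rsubmx v)).
  - exact: size_poly.
  - exact: size_poly.
  - apply/leq_sizeP => j le_kj.
    (* A coefficient of degree at least k is either recorded by [f] or beyond the size bound
       [sP]. *)
    have [lt_j|le_j] := ltnP (j - k) (n + n).
      by have := fv0 (Ordinal lt_j); rewrite !mxE /= subnKC.
    by apply: nth_default; apply: leq_trans (sP v) _; lia.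
  move=> /(congr1 (@poly_rV K n)) + /(congr1 (@poly_rV K n)).
  rewrite !rVpolyK linear0 => l0 r0.
  by rewrite -[v]hsubmxK l0 r0 row_mx0.
pose v : 'rV[K]_(n + n) := delta_mx 0 (lshift n ord0) *m invmx (lin1_mx L).
have fv : f v = delta_mx 0 (lshift n ord0).
  by have := mul_rV_lin1 L v; rewrite mulmxKV // -row_free_unit.
have cP j : (k <= j)%N -> (P v)`_j = (j == k)%:R.
  move=> le_kj; have [lt_j|le_j] := ltnP (j - k) (n + n).
    have /rowP/(_ (Ordinal lt_j)) := fv; rewrite !mxE /= subnKC // => ->.
    rewrite -val_eqE /=; congr (nat_of_bool _)%:R; lia.
  rewrite nth_default; last by apply: leq_trans (sP v) _; lia.
  have /negPf-> // : j != k; lia.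
have sPv : size (P v) = k.+1.
  apply/eqP; rewrite eqn_leq; apply/andP; split.
    by apply/leq_sizeP => j lt_kj; rewrite cP 1?ltnW // gtn_eqF.
  by rewrite ltnNge; apply/negP => /leq_sizeP/(_ k (leqnn k))/eqP; rewrite cP ?eqxx ?oner_eq0.
exists (rVpoly (lsubmx v)), (rVpoly (rsubmx v)); split => //; try exact: size_poly.
by rewrite monicE /lead_coef -/(P v) sPv cP ?eqxx.
Qed.
End Univariate.

(** * Monic families with one member in each degree, over an arbitrary coefficient ring *)

Section GradedFamily.
Set Implicit Arguments.
Unset Strict Implicit.
Variables (S : nzRingType) (f : nat -> {poly S}).
Hypotheses (f_size : forall i, size (f i) = i.+1) (f_monic : forall i, f i \is monic).

Lemma size_graded_sum n m (P : pred 'I_n) (g : nat -> S) :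
  (forall i : 'I_n, P i -> (i < m)%N) ->
  (size (\sum_(i < n | P i) g i *: f i)%R <= m)%N.
Proof.
move=> ltPm; apply: leq_trans (size_sum _ _ _) _; apply/bigmax_leqP => i Pi.
by apply: leq_trans (size_scale_leq _ _) _; rewrite f_size ltPm.
Qed.

(** The coefficient of top degree isolates the last [g n]. Monic members make division unnecessary,
    so this serves over [K] and also over [{poly K}]. *)
Lemma graded_free n (g : nat -> S) :
  \sum_(i < n) g i *: f i = 0 -> forall i, (i < n)%N -> g i = 0.
Proof.
elim: n => [//|n IH]; rewrite big_ord_recr /= => s0.
have gn0 : g n = 0.
  have /(congr1 (fun p : {poly S} => p`_n)) := s0.
  rewrite coefD coefZ coef0 nth_default ?add0r; last exact: size_graded_sum.
  by have /monicP := f_monic n; rewrite /lead_coef f_size /= => ->; rewrite mulr1.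
move: s0; rewrite gn0 scale0r addr0 => /IH g0 i; rewrite ltnS leq_eqVlt.
by case/predU1P => [->|/g0].
Qed.

Lemma graded_span n (p : {poly S}) :
  (size p <= n)%N -> exists g : nat -> S, p = \sum_(i < n) g i *: f i.
Proof.
elim: n p => [|n IH] p.
  by rewrite leqn0 size_poly_eq0 => /eqP ->; exists (fun=> 0); rewrite big_ord0.
move=> sp; have [|g eg] := IH (p - p`_n *: f n).
  apply/leq_sizeP => j; rewrite leq_eqVlt coefB coefZ => /predU1P[<-|lt_nj].
    have /monicP := f_monic n; rewrite /lead_coef f_size /= => ->.
    by rewrite mulr1 subrr.
  rewrite [p`_j]nth_default ?(leq_trans sp) // [(f n)`_j]nth_default ?f_size //.
  by rewrite mulr0 subr0.
exists (fun i => if i == n then p`_n else g i).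
rewrite big_ord_recr /= eqxx -[LHS](subrK (p`_n *: f n)) eg; congr (_ + _).
by apply: eq_bigr => i _; rewrite ltn_eqF.
Qed.

End GradedFamily.

(** * Homogenization of univariate polynomials, evaluated in an algebra *)

Section Homogenization.
Set Implicit Arguments.
Unset Strict Implicit.
Variables (K : comNzRingType) (A : comAlgType K).
Implicit Types (p q : {poly K}) (u v : A).

(** Formally v^d p(u/v) when deg p <= d. Coefficients of degree above d are dropped, whence the size
    hypotheses of some of the lemmas below. *)
Definition homogenize d p u v : A := \sum_(k < d.+1) p`_k *: (u ^+ k * v ^+ (d - k)).

Lemma homogenizeD d p q u v :
  homogenize d (p + q) u v = homogenize d p u v + homogenize d q u v.
Proof. by rewrite -big_split; apply: eq_bigr => k _; rewrite coefD scalerDl. Qed.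

Lemma homogenizeZ d c p u v : homogenize d (c *: p) u v = c *: homogenize d p u v.
Proof. by rewrite scaler_sumr; apply: eq_bigr => k _; rewrite coefZ scalerA. Qed.

Lemma homogenize_sum d n (F : 'I_n -> {poly K}) u v :
  homogenize d (\sum_i F i) u v = \sum_i homogenize d (F i) u v.
Proof.
apply: (big_morph (fun p => homogenize d p u v)) => [p q|]; first exact: homogenizeD.
by rewrite /homogenize big1 // => k _; rewrite coef0 scale0r.
Qed.

Lemma homogenizeXn d u v : homogenize d 'X^d u v = u ^+ d.
Proof.
rewrite /homogenize big_ord_recr /= big1 => [|k _]; last first.
  by rewrite coefXn ltn_eqF // scale0r.
by rewrite add0r coefXn eqxx scale1r subnn mulr1.
Qed.

Lemma homogenizeS d p u v :
  (size p <= d.+1)%N -> homogenize d.+1 p u v = homogenize d p u v * v.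
Proof.
move=> sp; rewrite /homogenize big_ord_recr /= nth_default // scale0r addr0.
rewrite mulr_suml; apply: eq_bigr => k _.
by rewrite -scalerAl -mulrA -exprSr subSn // -ltnS.
Qed.

Lemma homogenizeMX d p u v : homogenize d.+1 (p * 'X) u v = homogenize d p u v * u.
Proof.
rewrite /homogenize big_ord_recl coefMX eqxx scale0r add0r mulr_suml.
by apply: eq_bigr => k _; rewrite coefMX /= /bump /= add1n subSS -scalerAl exprSr mulrAC.
Qed.

Lemma homogenizeMX1 d p u v : (size p <= d.+1)%N ->
  homogenize d.+1 (p * ('X + 1)) u v = homogenize d p u v * (u + v).
Proof.
by move=> sp; rewrite mulrDr mulr1 homogenizeD homogenizeMX homogenizeS // mulrDr.
Qed.

Lemma homogenize_add d m p u v : (size p <= d.+1)%N ->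
  homogenize (d + m) p u v = homogenize d p u v * v ^+ m.
Proof.
move=> sp; elim: m => [|m IH]; first by rewrite addn0 mulr1.
by rewrite addnS homogenizeS ?IH ?exprSr ?mulrA // (leq_trans sp) // ltnS leq_addr.
Qed.

Lemma homogenizeMXn d m p u v :
  homogenize (d + m) (p * 'X^m) u v = homogenize d p u v * u ^+ m.
Proof.
elim: m => [|m IH]; first by rewrite addn0 !mulr1.
by rewrite addnS exprSr mulrA homogenizeMX IH exprSr mulrA.
Qed.

Lemma homogenizeMX1n d m p u v : (size p <= d.+1)%N ->
  homogenize (d + m) (p * ('X + 1) ^+ m) u v = homogenize d p u v * (u + v) ^+ m.
Proof.
move=> sp; elim: m => [|m IH]; first by rewrite addn0 !mulr1.
rewrite addnS exprSr mulrA homogenizeMX1 ?IH ?exprSr ?mulrA //.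
apply: leq_trans (size_polyMleq _ _) _.
have : (size (('X + 1) ^+ m : {poly K})%R <= m.+1)%N.
  by apply: leq_trans (size_poly_exp_leq _ _) _; rewrite size_XaddC mul1n.
by move: sp; size_lia.
Qed.

(** Putting v = 1 undoes homogenization. Scalars pass through [iota] because [B] is only a ring; it
    will be [{poly {poly K}}], with [K] embedded as constants. *)
Lemma homogenize_root1 (B : comNzRingType) (phi : {rmorphism A -> B})
    (iota : {rmorphism K -> B}) d p u v :
  (forall c w, phi (c *: w) = iota c * phi w) -> phi v = 1 -> (size p <= d.+1)%N ->
  phi (homogenize d p u v) = (map_poly iota p).[phi u].
Proof.
move=> phiZ phiv sp.
have sp' : (size (map_poly iota p) <= d.+1)%N.
  exact: leq_trans (size_poly _ _) sp.
rewrite (horner_coef_wide _ sp') rmorph_sum /=; apply: eq_bigr => k _.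
by rewrite phiZ coef_map rmorphM !rmorphXn /= phiv expr1n mulr1.
Qed.
End Homogenization.

(** * The Pade basis e_i and the forms built from it *)

Section PadeBasis.
Set Implicit Arguments.
Unset Strict Implicit.
Variables (K : numFieldType) (r : nat).

(* [X^(r+1)] and [(X+1)^(r+1)] are x^(r+1) and (x+y)^(r+1) at y = 1.  The elements of
   index above r only serve to have a basis indexed by all of nat. *)
Record pade_basis := PadeBasis {
  pb_elt :> nat -> {poly K};
  pb_left : nat -> {poly K};
  pb_right : nat -> {poly K};
  pb_size : forall i, size (pb_elt i) = i.+1;
  pb_monic : forall i, pb_elt i \is monic;
  pb_size_left : forall i, (i <= r)%N -> (size (pb_left i) <= r.+1 - i)%N;
  pb_size_right : forall i, (i <= r)%N -> (size (pb_right i) <= r.+1 - i)%N;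
  pb_eltE : forall i, (i <= r)%N ->
    pb_elt i = pb_left i * 'X^(r.+1) + pb_right i * ('X + 1) ^+ r.+1
}.

Lemma pade_basis_exists : inhabited pade_basis.
Proof.
have /choice[g gP] : forall i, exists t : {poly K} * {poly K} * {poly K},
    [/\ size t.1.1 = i.+1, t.1.1 \is monic & (i <= r)%N ->
      [/\ (size t.1.2 <= r.+1 - i)%N, (size t.2 <= r.+1 - i)%N &
          t.1.1 = t.1.2 * 'X^(r.+1) + t.2 * ('X + 1) ^+ r.+1]].
  (* For i <= r, [pade_exists] is used with k = i and t = r - i, which makes the exponent r + 1;
     above r the power ['X^i] fills in. *)
  move=> i; have [le_ir|lt_ri] := leqP i r; last first.
    by exists ('X^i, 0, 0); rewrite size_polyXn monicXn; split.
  have [a [b []]] := pade_exists K i (r - i).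
  have -> : (i + (r - i).+1 = r.+1)%N by lia.
  rewrite -subSn // => sa sb s mon.
  by exists (a * 'X^(r.+1) + b * ('X + 1) ^+ r.+1, a, b); split.
split; apply: (@PadeBasis (fun i => (g i).1.1) (fun i => (g i).1.2) (fun i => (g i).2)) => i;
  have [] // := gP i; try by move=> _ _ + le_ir => /(_ le_ir) [].
Qed.

Variable e : pade_basis.

(** Subtract the terms with i >= j: their multipliers have size at most r + 1 - i <= r + 1 - j, so
    the right-hand side keeps its shape. What remains on the left involves only i < j, so it has
    size at most j, and [pade_unique] with k = j, t = r + 1 - j makes it zero. *)
Lemma pade_coef_vanish (j : nat) (c : nat -> K) (a b : {poly K}) : (j <= r)%N ->
  (size a <= r.+1 - j)%N -> (size b <= r.+1 - j)%N ->
  \sum_(i < r.+1 | (i + j <= r)%N) c i *: e i = a * 'X^(r.+1) + b * ('X + 1) ^+ r.+1 ->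
  forall i, (i < j)%N -> (i + j <= r)%N -> c i = 0.
Proof.
move=> le_jr sa sb eqs.
pose s (p : nat -> {poly K}) : {poly K} :=
  \sum_(i < r.+1 | (i + j <= r)%N && (j <= i)%N) c i *: p i.
have ss (p : nat -> {poly K}) : (forall i, (i <= r)%N -> (size (p i) <= r.+1 - i)%N) ->
    (size (s p) <= r.+1 - j)%N.
  move=> sp; apply: leq_trans (size_sum _ _ _) _; apply/bigmax_leqP => i /andP[_ le_ji].
  apply: leq_trans (size_scale_leq _ _) _; have lti := ltn_ord i; apply: leq_trans (sp i _) _; lia.
have es : s e = s (pb_left e) * 'X^(r.+1) + s (pb_right e) * ('X + 1) ^+ r.+1.
  rewrite /s !mulr_suml -big_split; apply: eq_bigr => i _ /=.
  have le_ir : (i <= r)%N by rewrite -ltnS.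
  by rewrite (pb_eltE e le_ir) scalerDr !scalerAl.
(* The surviving coefficients, extended by zero so that [graded_free] applies to an unrestricted
   sum. *)
pose g i := if (i + j <= r)%N && (i < j)%N then c i else 0.
have sum_g : \sum_(i < r.+1) g i *: e i =
    (a - s (pb_left e)) * 'X^(r.+1) + (b - s (pb_right e)) * ('X + 1) ^+ r.+1.
  rewrite !mulrBl addrACA -opprD -es -eqs [X in X - _](bigID (fun i : 'I__ => (j <= i)%N)) /=.
  rewrite [X in X - _]addrC addrK [RHS]big_mkcond; apply: eq_bigr => i _.
  by rewrite /g ltnNge; case: ifP; rewrite ?scale0r.
have sub_size (p q : {poly K}) n : (size p <= n)%N -> (size q <= n)%N -> (size (p - q)%R <= n)%N.
  by move=> sp sq; rewrite (leq_trans (size_polyD _ _)) // geq_max sp size_polyN.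
have g0 : \sum_(i < r.+1) g i *: e i = 0.
  have Nj : r.+1 = (j + (r.+1 - j))%N by lia.
  have [] := @pade_unique K j (r.+1 - j) (a - s (pb_left e)) (b - s (pb_right e)).
  - by apply: sub_size; rewrite ?ss //; apply: pb_size_left.
  - by apply: sub_size; rewrite ?ss //; apply: pb_size_right.
  - rewrite -Nj -sum_g (bigID (fun i : 'I__ => (i < j)%N)) /= [X in _ + X]big1.
      by rewrite addr0; apply: size_graded_sum => //; apply: pb_size.
    by move=> i /negPf nij; rewrite /g nij andbF scale0r.
  by move=> a0 b0; rewrite sum_g a0 b0 !mul0r addr0.
move=> i lt_ij le_ijr.
have := graded_free (pb_size e) (pb_monic e) g0 (i := i).
by rewrite /g le_ijr lt_ij; apply; lia.
Qed.

(** * The forms y^(r-i-j) e_i(x, y) e_j(z, y): span and membership in the colon ideal *)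

Section Products.
Variable A : comAlgType K.
Implicit Types (x y z : A) (c : nat -> nat -> K).

(** The three variables are arguments, so that the symmetry x <-> z becomes an exchange of arguments
    and indices. *)
Definition pprod x y z i j : A :=
  homogenize i (e i) x y * homogenize j (e j) z y * y ^+ (r - i - j).

Definition pcomb c x y z : A :=
  \sum_(i < r.+1) \sum_(j < r.+1 | (i + j <= r)%N) c i j *: pprod x y z i j.

Lemma pprodC x y z i j : pprod x y z i j = pprod z y x j i.
Proof. by rewrite /pprod subnAC [_ * homogenize j _ _ _]mulrC. Qed.

Lemma pcombC c x y z : pcomb c x y z = pcomb (fun i j => c j i) z y x.
Proof.
rewrite /pcomb (exchange_big_dep xpredT) //=; apply: eq_bigr => i _.
by apply: eq_big => j; rewrite addnC // pprodC.
Qed.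

Lemma pcombD c d x y z : pcomb c x y z + pcomb d x y z = pcomb (fun i j => c i j + d i j) x y z.
Proof.
rewrite /pcomb -big_split; apply: eq_bigr => i _ /=; rewrite -big_split.
by apply: eq_bigr => j _; rewrite scalerDl.
Qed.

Lemma pcombZ k c x y z : k *: pcomb c x y z = pcomb (fun i j => k * c i j) x y z.
Proof.
rewrite /pcomb scaler_sumr; apply: eq_bigr => i _ /=; rewrite scaler_sumr.
by apply: eq_bigr => j _; rewrite scalerA.
Qed.

Lemma pcomb_sum (I : Type) (s : seq I) (P : pred I) (F : I -> A) x y z :
  (forall i, P i -> exists c, F i = pcomb c x y z) ->
  exists c, \sum_(i <- s | P i) F i = pcomb c x y z.
Proof.
move=> FP; apply: (big_ind (fun f => exists c, f = pcomb c x y z)) => //.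
  exists (fun _ _ => 0); rewrite /pcomb big1 // => i _.
  by rewrite big1 // => j _; rewrite scale0r.
by move=> _ _ [c ->] [d ->]; rewrite pcombD; eexists.
Qed.

Lemma pcomb1 x y z i j : (i + j <= r)%N -> exists c, pprod x y z i j = pcomb c x y z.
Proof.
move=> le_ijr; have lt_i : (i < r.+1)%N by lia. have lt_j : (j < r.+1)%N by lia.
exists (fun i' j' => ((i' == i) && (j' == j))%:R).
rewrite /pcomb (bigD1 (Ordinal lt_i)) //= (bigD1 (Ordinal lt_j)) //= !eqxx scale1r.
rewrite !big1 ?addr0 // => [i' ni|j' /andP[_ nj]].
  by rewrite big1 // => j' _; rewrite -val_eqE /= in ni; rewrite (negPf ni) scale0r.
by rewrite -val_eqE /= in nj; rewrite (negPf nj) scale0r.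
Qed.

(** The diagonal indices with 2i <= r are those below [r./2.+1]; this count becomes the
    dimension. *)
Lemma pcomb_diag (k : nat -> K) x y z :
  pcomb (fun i j => if i == j then k i else 0) x y z =
  \sum_(i < r./2.+1) k i *: pprod x y z i i.
Proof.
have le_r : (r./2.+1 <= r.+1)%N by lia.
rewrite (big_ord_widen r.+1 (fun i => k i *: pprod x y z i i)) // big_mkcond.
apply: eq_bigr => i _; rewrite big_mkcond (bigD1 i) //= big1 => [|j].
  by rewrite addr0 eqxx; have -> : (i + i <= r)%N = (i < r./2.+1)%N by lia.
by rewrite eq_sym -val_eqE /= => /negPf ->; rewrite scale0r if_same.
Qed.

Lemma expr_span x y d :
  exists s : nat -> K, x ^+ d = \sum_(i < d.+1) s i *: (homogenize i (e i) x y * y ^+ (d - i)).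
Proof.
have [|s es] := graded_span (pb_size e) (pb_monic e) (n := d.+1) (p := 'X^d).
  by rewrite size_polyXn.
exists s; rewrite -[LHS](homogenizeXn d x y) es homogenize_sum.
apply: eq_bigr => i _; rewrite homogenizeZ -homogenize_add ?pb_size ?subnKC //.
by rewrite -ltnS.
Qed.

(** Expanding x^m0 and z^m2 by [expr_span] leaves the powers y^(m0-i), y^m1 and y^(m2-j), whose
    exponents add up to r - i - j. *)
Lemma monomial_span x y z m0 m1 m2 : (m0 + m1 + m2 = r)%N ->
  exists c, x ^+ m0 * y ^+ m1 * z ^+ m2 = pcomb c x y z.
Proof.
move=> mr; have [s ->] := expr_span x y m0; have [t ->] := expr_span z y m2.
rewrite mulrAC !mulr_suml; apply: pcomb_sum => i _; rewrite mulr_sumr mulr_suml.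
apply: pcomb_sum => j _.
have lti := ltn_ord i; have ltj := ltn_ord j.
have [|c ec] := pcomb1 x y z (i := i) (j := j); first by lia.
exists (fun i' j' => (s i * t j) * c i' j'); rewrite -pcombZ -ec /pprod.
have -> : (r - i - j = (m0 - i) + m1 + (m2 - j))%N by lia.
rewrite !exprD -!scalerAl -scalerAr -!scalerAl scalerA; congr (_ *: _); ring.
Qed.

(** Homogenizing [pb_eltE] in degree 2r + 1 - i puts e_i(x, y) y^(2r+1-2i) in the ideal. The
    left-hand side here is e_i(x, y) e_j(z, y) y^(2r+1-i-j), and j <= i leaves the cofactor [w],
    with the surplus y^(i-j). *)
Lemma pprod_colon x y z i j : (j <= i)%N -> (i + j <= r)%N ->
  exists s t, pprod x y z i j * y ^+ r.+1 = s * x ^+ r.+1 + t * (x + y) ^+ r.+1.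
Proof.
move=> le_ji le_ijr; pose w := homogenize j (e j) z y * y ^+ (i - j).
have le_ir : (i <= r)%N by lia.
exists (homogenize (r - i) (pb_left e i) x y * w), (homogenize (r - i) (pb_right e i) x y * w).
rewrite ![_ * w * _]mulrAC -homogenizeMXn -homogenizeMX1n -?subSn ?pb_size_right //.
rewrite -mulrDl -homogenizeD -pb_eltE //.
have -> : (r - i + r.+1 = i + (r - i + r.+1 - i))%N by lia.
rewrite homogenize_add ?pb_size // /pprod /w.
(* All powers of y are split into y^(2j+1), y^(r-i-j) and y^(i-j), after which the identity is
   purely a ring identity. *)
have -> : y ^+ r.+1 = y ^+ (i + j).+1 * y ^+ (r - i - j) by rewrite -exprD; congr (_ ^+ _); lia.
have -> : y ^+ (r - i + r.+1 - i) = y ^+ (j + j).+1 * y ^+ (r - i - j) * y ^+ (r - i - j).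
  by rewrite -!exprD; congr (_ ^+ _); lia.
have -> : y ^+ (i + j).+1 = y ^+ (j + j).+1 * y ^+ (i - j).
  by rewrite -exprD; congr (_ ^+ _); lia.
ring.
Qed.

(** * The chart y = 1, with x as inner and z as outer variable of [{poly {poly K}}] *)

Section Dehomogenize.
Variables (x y z : A) (phi : {rmorphism A -> {poly {poly K}}}).
Hypothesis phiZ : forall k w, phi (k *: w) = k%:P%:P * phi w.
Hypotheses (phix : phi x = 'X%:P) (phiy : phi y = 1) (phiz : phi z = 'X).

(** The coefficient of e_j(z) in the image of [pcomb c x y z], a polynomial in x; the constraint i +
    j <= r bounds its degree by r - j. *)
Let level c j := \sum_(i < r.+1 | (i + j <= r)%N) c i j *: e i.

Lemma phi_pcomb c :
  phi (pcomb c x y z) = \sum_(j < r.+1) level c j *: map_poly polyC (e j).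
Proof.
pose iota : {rmorphism K -> {poly {poly K}}} := polyC \o polyC.
have phiE i w : phi (homogenize i (e i) w y) = (map_poly polyC (map_poly polyC (e i))).[phi w].
  rewrite (homogenize_root1 (iota := iota)) ?pb_size //; congr _.[_].
  by rewrite -map_poly_comp.
rewrite /pcomb (exchange_big_dep xpredT) //= rmorph_sum /=; apply: eq_bigr => j _.
rewrite rmorph_sum /= scaler_suml; apply: eq_bigr => i _.
rewrite phiZ /pprod !rmorphM /= rmorphXn /= phiy expr1n mulr1 !phiE phix phiz.
(* Evaluation at the variable is composition with ['X], hence the identity; for x this happens
   inside the constants of the outer ring. *)
rewrite horner_map -!/(_ \Po 'X) !comp_polyXr.
by rewrite -!mul_polyC polyCM mulrA.
Qed.

Lemma size_level c j : (j <= r)%N -> (size (level c j) <= r.+1 - j)%N.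
Proof.
by move=> le_jr; apply: (@size_graded_sum _ _ (pb_size e) _ _ _ (c^~ j)) => i le_ij; lia.
Qed.

Let lift_free (g : nat -> {poly K}) : \sum_(j < r.+1) g j *: map_poly polyC (e j) = 0 ->
  forall j, (j < r.+1)%N -> g j = 0.
Proof.
apply: (@graded_free _ (fun j => map_poly polyC (e j))) => j.
  by rewrite size_map_polyC pb_size.
by rewrite monic_map ?pb_monic.
Qed.

(** Freeness is used twice: over [{poly K}] in the outer variable, then over [K] in the inner
    one. *)
Lemma pcomb_free c : pcomb c x y z = 0 -> forall i j, (i + j <= r)%N -> c i j = 0.
Proof.
move=> /(congr1 phi); rewrite phi_pcomb rmorph0 => /lift_free c0 i j le_ijr.
have /c0 : (j < r.+1)%N by lia.
rewrite /level big_mkcond (eq_bigr (fun i : 'I__ => (if (i + j <= r)%N then c i j else 0) *: e i)).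
  move/(graded_free (pb_size e) (pb_monic e)
    (g := fun i => if (i + j <= r)%N then c i j else 0))/(_ i).
  by rewrite le_ijr; apply; lia.
by move=> i' _; case: ifP; rewrite ?scale0r.
Qed.

(** At y = 1 the factors ['X^(r.+1)] and [('X + 1) ^+ r.+1] do not involve z, so comparing
    coefficients of e_j(z) gives one equation in x for each j. The cofactors have levels of size at
    most r + 1 - j, as [pade_coef_vanish] requires. *)
Lemma pcomb_colon_vanish c s t :
  pcomb c x y z * y ^+ r.+1 = pcomb s x y z * x ^+ r.+1 + pcomb t x y z * (x + y) ^+ r.+1 ->
  forall i j, (i < j)%N -> (i + j <= r)%N -> c i j = 0.
Proof.
move=> /(congr1 phi).
rewrite rmorphD !rmorphM !rmorphXn rmorphD /= phix phiy expr1n mulr1 !phi_pcomb.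
move=> ceq i j lt_ij le_ijr.
pose g k := level c k - (level s k * 'X^(r.+1) + level t k * ('X + 1) ^+ r.+1).
have /lift_free g0 : \sum_(k < r.+1) g k *: map_poly polyC (e k) = 0.
  under eq_bigr do rewrite scalerBl scalerDl.
  rewrite sumrB big_split /= ceq; apply/eqP; rewrite subr_eq0; apply/eqP.
  rewrite !mulr_suml; congr (_ + _); apply: eq_bigr => k _.
    by rewrite mulrC -rmorphXn /= mul_polyC scalerA mulrC.
  by rewrite mulrC -[1 in LHS](rmorph1 polyC) -rmorphD -rmorphXn /= mul_polyC scalerA mulrC.
apply: (@pade_coef_vanish j (c^~ j) (level s j) (level t j)) => //; try lia.
- by apply: size_level; lia.
- by apply: size_level; lia.
- by apply/eqP; rewrite -subr_eq0; apply/eqP/g0; lia.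
Qed.

End Dehomogenize.
End Products.
End PadeBasis.

(** * The degree-r component of the intersection in three variables *)

Section ColonIntersection.
Set Implicit Arguments.
Unset Strict Implicit.

Lemma in_gen2 (A : comNzRingType) (g1 g2 f : A) :
  in_gen [:: g1; g2] f <-> exists s t, f = s * g1 + t * g2.
Proof.
split=> [[c ->]|[s [t ->]]].
  by exists (c ord0), (c (lift ord0 ord0)); rewrite !big_ord_recl big_ord0 addr0.
exists (fun i => if i == ord0 then s else t).
by rewrite !big_ord_recl big_ord0 addr0.
Qed.

Lemma pihomogM_dhomog n (K : comNzRingType) (d d' : nat) (p q : {mpoly K[n]}) :
  q \is d'.-homog -> pihomog mdeg (d + d') (p * q) = pihomog mdeg d p * q.
Proof.
(* The bound exceeds d even when d is at least [msize p], so that the component of degree d occurs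
   in the decomposition. *)
move=> homq; pose k := maxn (msize p) d.+1.
have lt_dk : (d < k)%N by rewrite leq_maxr.
rewrite {1}(pihomog_partitionE (mf := mdeg) (leq_maxl (msize p) d.+1)) -/k.
rewrite mulr_suml raddf_sum /= (bigD1 (Ordinal lt_dk)) //= big1 => [|i ne_id].
  by rewrite addr0 pihomog_dE // dhomogM ?pihomogP.
rewrite (@pihomog_ne0 _ _ _ (i + d')%N) ?dhomogM ?pihomogP //.
by rewrite eqn_add2r -val_eqE /= in ne_id *.
Qed.

Variables (K : numFieldType) (r : nat).
Local Notation mpol := {mpoly K[3]}.
Let x : mpol := 'X_(@Ordinal 3 0 isT).
Let y : mpol := 'X_(@Ordinal 3 1 isT).
Let z : mpol := 'X_(@Ordinal 3 2 isT).

Let homogX i : 'X_i \is [in K[3], 1.-homog].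
Proof. by rewrite dhomogX /= mdeg1. Qed.

Variable e : pade_basis K r.

Let pcomb_span (f : mpol) : f \is r.-homog -> exists c, f = pcomb e c x y z.
Proof.
move=> /dhomogP homf; rewrite (mpolyE f) big_seq; apply: pcomb_sum => m /homf mdegm.
have [|c ec] := @monomial_span K r e _ x y z
  (m (@Ordinal 3 0 isT)) (m (@Ordinal 3 1 isT)) (m (@Ordinal 3 2 isT)).
  rewrite -mdegm /= mdegE !big_ord_recl big_ord0 addn0 addnA.
  by do ?congr (_ + _)%N; congr (m _); apply: val_inj.
exists (fun i j => f@_m * c i j); rewrite -pcombZ -ec; congr (_ *: _).
rewrite mpolyXE_id !big_ord_recl big_ord0 mulr1 mulrA.
by do ?congr (_ * _); congr ('X_ _ ^+ m _); apply: val_inj.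
Qed.

Let dehomog (u v w : {poly {poly K}}) :
  exists phi : {rmorphism mpol -> {poly {poly K}}},
    [/\ forall k p, phi (k *: p) = k%:P%:P * phi p, phi x = u, phi y = v & phi z = w].
Proof.
exists (mmap (polyC \o polyC)
  (fun i => if i == 0 :> nat then u else if i == 1 :> nat then v else w)).
by split=> [k p|||] /=; rewrite ?mmapZ // mmapX mmap1U.
Qed.

Let homogenize_homog d p i j : homogenize d p 'X_i 'X_j \is [in K[3], d.-homog].
Proof.
apply: rpred_sum => k _; apply: rpredZ.
have le_kd : (k <= d)%N by rewrite -ltnS.
have := dhomogM (dhomogMn k (homogX i)) (dhomogMn (d - k) (homogX j)).
by rewrite !mul1n subnKC.
Qed.

Let pprod_homog i j : (i + j <= r)%N -> pprod e x y z i j \is [in K[3], r.-homog].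
Proof.
move=> le_ijr.
have := dhomogM (dhomogM (homogenize_homog i (e i) _ _) (homogenize_homog j (e j) _ _))
  (dhomogMn (r - i - j) (homogX _)).
by rewrite mul1n -subnDA subnKC // subnDA; apply.
Qed.

(** Taking the component of degree 2r + 1 of the membership equation replaces the cofactors by their
    components of degree r, which [pcomb_span] can then expand. *)
Let homog_colon (f u : mpol) : f \is r.-homog -> u \is 1.-homog ->
  in_colon (ideal_gen [:: u ^+ r.+1; (u + y) ^+ r.+1]) (y ^+ r.+1) f ->
  exists s t, [/\ s \is r.-homog, t \is r.-homog &
    f * y ^+ r.+1 = s * u ^+ r.+1 + t * (u + y) ^+ r.+1].
Proof.
move=> homf homu /in_gen2[s [t est]].
have homX (v : mpol) : v \is 1.-homog -> v ^+ r.+1 \is r.+1.-homog.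
  by move=> /(dhomogMn r.+1); rewrite mul1n.
exists (pihomog mdeg r s), (pihomog mdeg r t); split; rewrite ?pihomogP //.
have := congr1 (pihomog mdeg (r + r.+1)) est; rewrite pihomogD.
rewrite (pihomogM_dhomog _ _ (homX _ homu)) (pihomogM_dhomog _ _ (homX _ (homogX _))).
rewrite (pihomogM_dhomog _ _ (homX _ _)) ?(pihomog_dE homf) //.
exact: dhomogD homu (homogX _).
Qed.

Let I1 := ideal_colon (ideal_gen [:: x ^+ r.+1; (x + y) ^+ r.+1]) (y ^+ r.+1).
Let I2 := ideal_colon (ideal_gen [:: z ^+ r.+1; (z + y) ^+ r.+1]) (y ^+ r.+1).

Let cap_diag f : f \is r.-homog -> in_cap I1 I2 f ->
  exists k : nat -> K, f = \sum_(i < r./2.+1) k i *: pprod e x y z i i.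
Proof.
move=> homf [f1 f2].
have [c ec] := pcomb_span homf.
have [s [t [/pcomb_span[cs es] /pcomb_span[ct et] est]]] := homog_colon homf (homogX _) f1.
have [s' [t' [/pcomb_span[cs' es'] /pcomb_span[ct' et'] est']]] := homog_colon homf (homogX _) f2.
have c_lt i j : (i < j)%N -> (i + j <= r)%N -> c i j = 0.
  have [phi [phiZ phix phiy phiz]] := dehomog 'X%:P 1 'X.
  have := @pcomb_colon_vanish K r e _ x y z phi phiZ phix phiy phiz c cs ct.
  by rewrite -ec -es -et; apply; exact: est.
(* The same argument with x and z exchanged: z is now the inner variable and the coefficient
   families are transposed. *)
have c_gt i j : (j < i)%N -> (i + j <= r)%N -> c i j = 0.
  have [phi [phiZ phix phiy phiz]] := dehomog 'X 1 'X%:P.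
  rewrite [(i + j)%N]addnC.
  have := @pcomb_colon_vanish K r e _ z y x phi phiZ phiz phiy phix
    (fun i j => c j i) (fun i j => cs' j i) (fun i j => ct' j i).
  by rewrite -!(pcombC e _ x y z) -ec -es' -et'; apply; exact: est'.
exists (fun i => c i i); rewrite -(pcomb_diag e (fun i => c i i)) ec.
apply: eq_bigr => i _; apply: eq_bigr => j le_ijr; case: eqVneq => [-> //|].
rewrite neq_ltn => /orP[lt_ij|lt_ji]; first by rewrite c_lt.
by rewrite c_gt.
Qed.

Let diag_cap i : (i + i <= r)%N -> in_cap I1 I2 (pprod e x y z i i).
Proof.
move=> le_iir; split; apply/in_gen2; first exact: pprod_colon.
by rewrite pprodC; apply: pprod_colon.
Qed.

Lemma dim_hcomp_cap_colon : \dim (hcomp (ideal_cap I1 I2) r) = r./2.+1.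
Proof.
(* [indhomog] falls back to a default on forms of the wrong degree; [val_b] rules this out by
   [pprod_homog]. *)
pose b := [tuple indhomog r (pprod e x y z i i) | i < r./2.+1].
have val_b (i : 'I_r./2.+1) : mpoly_of_dhomog b`_i = pprod e x y z i i.
  rewrite -tnth_nth tnth_mktuple /indhomog insubdK //.
  by apply: pprod_homog; have := ltn_ord i; lia.
apply: (@vector.size_basis _ _ _ _ b); apply/andP; split.
  rewrite eqEsubv; apply/andP; split.
    apply/span_subvP => _ /tnthP[i ->]; apply/mem_hcomp.
    by rewrite (tnth_nth 0) val_b; apply: diag_cap; have := ltn_ord i; lia.
  apply/subvP => f /mem_hcomp/(cap_diag (dhomog_is_dhomog f))[k fE].
  have -> : f = \sum_(i < r./2.+1) k i *: b`_i.
    apply: val_inj; rewrite linear_sum /= fE; apply: eq_bigr => i _.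
    by rewrite -[in LHS](val_b i).
  by apply: rpred_sum => i _; apply/rpredZ/memv_span/mem_nth; rewrite size_tuple.
apply/freeP => k /(congr1 (@mpoly_of_dhomog _ _ _)).
rewrite linear_sum linear0 /= => k0 i.
(* Extension by zero of [k] to all of [nat], the domain that [pcomb_diag] expects. *)
pose k' n := if insub n is Some i then k i else 0.
have k'E (j : 'I_r./2.+1) : k' j = k j by rewrite /k' valK.
have [phi [phiZ phix phiy phiz]] := dehomog 'X%:P 1 'X.
have := pcomb_free phiZ phix phiy phiz (e := e) (c := fun i j => if i == j then k' i else 0).
rewrite pcomb_diag => /(_ _ i i); rewrite eqxx k'E; apply; last by have := ltn_ord i; lia.
by rewrite -[RHS]k0; apply: eq_bigr => j _; rewrite -val_b k'E.
Qed.

End ColonIntersection.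

(** The odd case reads [r.+1 = (2 * n)%N] because with truncated subtraction r = 2n - 1 would also
    admit r = n = 0, where the dimension is 1. Both cases are values of [r./2.+1]. *)
Theorem theorem1p2 (R : realType) (r : nat) :
  let x : {mpoly R[3]} := 'X_(@Ordinal 3 0 isT) in
  let y : {mpoly R[3]} := 'X_(@Ordinal 3 1 isT) in
  let z : {mpoly R[3]} := 'X_(@Ordinal 3 2 isT) in
  let I1 := ideal_colon (ideal_gen [:: x ^+ r.+1; (x + y) ^+ r.+1]) (y ^+ r.+1) in
  let I2 := ideal_colon (ideal_gen [:: z ^+ r.+1; (z + y) ^+ r.+1]) (y ^+ r.+1) in
  (forall n : nat, r.+1 = (2 * n)%N -> \dim (hcomp (ideal_cap I1 I2) r) = n) /\
  (forall n : nat, r = (2 * n)%N -> \dim (hcomp (ideal_cap I1 I2) r) = n.+1).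
Proof.
move=> x y z I1 I2; have [e] := pade_basis_exists R r.
have dimE : \dim (hcomp (ideal_cap I1 I2) r) = r./2.+1 := dim_hcomp_cap_colon e.
by split=> n rn; rewrite dimE; lia.
Qed.
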